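(* Let $\Omega$ be a nonempty open convex subset of a Hilbert space $\mathcal{H}$ and let $f\colon \Omega\to \mathbb{R}$ be a convex function. Then $f\in C^{1,+}(\Omega)$ if and only if $f$ is Gâteaux differentiable on $\Omega$ and $\nabla f$ is locally cocoercive, that is, for every $x\in\Omega$ there exist a neighborhood $U\subset\Omega$ of $x$ and a constant $\beta>0$ such that $\nabla f$ is $\beta$-cocoercive on $U$.
   Context: $\mathcal{H}$ is a (real) Hilbert space with scalar product $\langle\cdot,\cdot\rangle$ and induced norm $\Vert\cdot\Vert$. For a constant $\beta>0$ and a set $U\subset\mathcal{H}$, an operator $T\colon U\to\mathcal{H}$ is $\beta$-cocoercive on $U$ if $\langle Tx-Ty,x-y\rangle\geq\beta\Vert Tx-Ty\Vert^2$ for all $x,y\in U$. For a Gâteaux differentiable function $f$, $\nabla f(x)\in\mathcal{H}$ denotes its (Gâteaux) gradient at $x$. $C^{1,+}(\Omega)$ denotes the class of Fréchet differentiable functions $f\colon\Omega\to\mathbb{R}$ whose gradient $\nabla f$ is locally Lipschitz on $\Omega$. *)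

(* Defs.v *)
From HB Require Import structures.
From mathcomp Require Import all_boot all_order all_algebra.
From mathcomp Require Export sesquilinear.
From mathcomp Require Import all_classical all_reals all_analysis.
Import Order.TTheory GRing.Theory Num.Theory.
Import numFieldNormedType.Exports.

Set Implicit Arguments.
Unset Strict Implicit.
Unset Printing Implicit Defensive.

Local Open Scope classical_set_scope.
Local Open Scope ring_scope.

(* A real Hilbert space is a [completeNormedModType R] together with a
   symmetric positive definite bilinear form [ip] inducing its norm.
   A function on an open set [Omega] is represented by a total function
   [H -> R]; only its values on [Omega] are relevant, since the
   derivatives at a point depend only on the germ of [f] at that point. *)

Section Hilbert.
Context {R : realType} {H : completeNormedModType R}.
Implicit Types (ip : {dot H for idfun}) (f : H -> R^o) (T : H -> H).
Implicit Types (U Omega : set H).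

Definition induces_norm ip := forall x : H, `|x| = Num.sqrt (ip x x).

Definition gateaux_differentiable f (x : H) :=
  exists l : {linear H -> R^o},
    continuous l /\ forall v, is_derive x v f (l v).

(* The Riesz representative of the Gateaux derivative of [f] at [x]
   (and 0 if [f] is not Gateaux differentiable at [x]). *)
Definition gradient ip f (x : H) : H :=
  xget 0 [set g | forall v, is_derive x v f (ip g v)].

Definition cocoercive ip (beta : R) U T :=
  forall x y, U x -> U y ->
    ip (T x - T y) (x - y) >= beta * `|T x - T y| ^+ 2.

Definition locally_cocoercive ip Omega T :=
  forall x, Omega x -> exists U, exists beta : R,
    [/\ nbhs x U, U `<=` Omega, 0 < beta & cocoercive ip beta U T].

Definition locally_lipschitz Omega T :=
  forall x, Omega x -> exists U,
    [/\ nbhs x U, U `<=` Omega & [lipschitz T y | y in U]].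

Definition C1plus ip Omega f :=
  (forall x, Omega x -> differentiable f x) /\
  locally_lipschitz Omega (gradient ip f).

End Hilbert.

(* Main.v *)
(* Convexity makes [grad f] a subgradient, so
   [0 <= f z - f y - <grad f y, z - y> <= <grad f z - grad f y, z - y>]; if
   [grad f] is [L]-Lipschitz the right-hand side is at most [L |z - y|^2].
   This non-sharp form of the descent lemma (the optimal constant is [L/2])
   needs no integration and serves both directions. Minimising it at
   [z = y - (grad f y - grad f x) / (2 L)] gives the Baillon-Haddad argument,
   and hence local cocoercivity, on a quarter of the radius, where [z] does not
   leave the ball. Conversely, cocoercivity implies Lipschitz continuity by
   Cauchy-Schwarz, and the quadratic bound then upgrades Gateaux to Frechet
   differentiability. *)
Require Import Defs.
From HB Require Import structures.
From mathcomp Require Import all_boot all_order all_algebra.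
From mathcomp Require Import all_classical all_reals all_analysis.
From mathcomp Require Import ring lra.
Import Order.TTheory GRing.Theory Num.Theory.
Import numFieldNormedType.Exports.
Local Open Scope classical_set_scope.
Local Open Scope ring_scope.

(** * Inner product identities, Cauchy-Schwarz and Riesz representation *)

Section InnerProduct.
Context {R : realType} {H : completeNormedModType R}.
Variable ip : {dot H for idfun}.

Lemma ipC u v : ip u v = ip v u.
Proof. by rewrite hermC expr0 mul1r. Qed.

Lemma ip0r u : ip u 0 = 0.
Proof. exact: linear0r. Qed.

Lemma ipDr u v w : ip u (v + w) = ip u v + ip u w.
Proof. exact: linearDr. Qed.

Lemma ipBr u v w : ip u (v - w) = ip u v - ip u w.
Proof. exact: linearBr. Qed.

Lemma ipZr u a v : ip u (a *: v) = a * ip u v.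
Proof. exact: linearZr_LR. Qed.

Lemma ip0l u : ip 0 u = 0.
Proof. by rewrite ipC ip0r. Qed.

Lemma ipDl u v w : ip (u + v) w = ip u w + ip v w.
Proof. by rewrite ipC ipDr !(ipC w). Qed.

Lemma ipBl u v w : ip (u - v) w = ip u w - ip v w.
Proof. by rewrite ipC ipBr !(ipC w). Qed.

Lemma ipZl a u v : ip (a *: u) v = a * ip u v.
Proof. by rewrite ipC ipZr ipC. Qed.

Hypothesis ip_norm : induces_norm ip.

Lemma ip_normE u : ip u u = `|u| ^+ 2.
Proof.
rewrite ip_norm sqr_sqrtr //; have [->|/neq0_dnorm_gt0/ltW//] := eqVneq u 0.
by rewrite ip0r.
Qed.

Lemma sqr_normB (u v : H) : `|u - v| ^+ 2 = `|u| ^+ 2 - 2 * ip u v + `|v| ^+ 2.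
Proof. by rewrite -!ip_normE ipBr !ipBl (ipC v u); ring. Qed.

Lemma sqr_normD (u v : H) : `|u + v| ^+ 2 = `|u| ^+ 2 + 2 * ip u v + `|v| ^+ 2.
Proof. by rewrite -!ip_normE ipDr !ipDl (ipC v u); ring. Qed.

Lemma sqr_normZ (a : R) (u : H) : `|a *: u| ^+ 2 = a ^+ 2 * `|u| ^+ 2.
Proof. by rewrite normrZ exprMn real_normK ?num_real. Qed.

Lemma ip_cauchy_schwarz u v : ip u v <= `|u| * `|v|.
Proof.
have [->|u0] := eqVneq u 0; first by rewrite ip0l normr0 mul0r.
have [->|v0] := eqVneq v 0; first by rewrite ip0r normr0 mulr0.
(* With a, b, c as named below, this square equals [2 * (a * b) * (a * b - c)], and [a * b] is
   positive. *)
have := sqr_ge0 `|(`|v| *: u - `|u| *: v)|.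
rewrite sqr_normB !sqr_normZ ipZl ipZr.
have : 0 < `|u| * `|v| by rewrite mulr_gt0 ?normr_gt0.
set a := `|u|; set b := `|v|; set c := ip u v => ab0 h.
rewrite -subr_ge0 -(pmulr_rge0 _ ab0); nra.
Qed.

(* The representative minimises the energy [|v|^2 - 2 l v]; by the
   parallelogram identity its sublevel sets form a Cauchy filter. *)
Lemma riesz (l : {linear H -> R^o}) : continuous l ->
  exists g, forall v, l v = ip g v.
Proof.
move=> lc; have [k k0 lk] := linear_lipschitz lc.
have lD u v : l (u + v) = l u + l v by exact: linearD.
have lZ a u : l (a *: u) = a * l u by exact: linearZ.
pose J (v : H) : R := `|v| ^+ 2 - 2 * l v.
have JE (v : H) : J v = `|v| ^+ 2 - 2 * l v by [].
have J_lb v : - k ^+ 2 <= J v.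
  have := lk v; have := ler_norm (l v); rewrite JE => h1 h2.
  have := sqr_ge0 (`|v| - k); rewrite sqrrB.
  have h3 : l v <= k * `|v| := le_trans h1 h2.
  set a := `|v| in h3 *; set b := (l v : R) in h3 *; nra.
pose m := inf (range J).
have J_hlb : has_lbound (range J).
  by exists (- k ^+ 2) => _ [v _ <-]; exact: J_lb.
have J_inf : has_inf (range J) by split => //; exists (J 0), 0.
have mJ v : m <= J v by apply: ge_inf => //; exists v.
have J_par u v : `|u - v| ^+ 2 <= 2 * (J u - m) + 2 * (J v - m).
  have := mJ (2^-1 *: (u + v)).
  rewrite !JE lZ lD sqr_normZ sqr_normD sqr_normB /= => h.
  have -> : 2 * (`|u| ^+ 2 - 2 * l u - m) + 2 * (`|v| ^+ 2 - 2 * l v - m) =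
    `|u| ^+ 2 - 2 * ip u v + `|v| ^+ 2 +
    4 * (2^-1 ^+ 2 * (`|u| ^+ 2 + 2 * ip u v + `|v| ^+ 2) -
      2 * (2^-1 * (l u + l v)) - m) by field.
  by rewrite lerDl mulr_ge0 ?subr_ge0.
pose F := filter_from [set e : R | 0 < e] (fun e => [set v | J v < m + e]).
have FF : ProperFilter F.
  apply: filter_from_proper; last first.
    move=> e /= e0; have [_ [v _ <-] Jv] := inf_adherent e0 J_inf.
    by exists v.
  apply: filter_from_filter; first by exists 1 => /=.
  move=> i j /= i0 j0; exists (Num.min i j); first by rewrite lt_min i0.
  by move=> v /= Jv; split; apply: (lt_le_trans Jv);
    rewrite lerD2l ge_min lexx ?orbT.
have /cauchy_cvg : cauchy F.
  apply/cauchy_exP => e e0.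
  have e20 : 0 < e ^+ 2 / 4 by rewrite divr_gt0 ?exprn_gt0.
  have [_ [v _ <-] Jv] := inf_adherent e20 J_inf.
  exists v, (e ^+ 2 / 4) => // u /= Ju; rewrite -ball_normE /=.
  rewrite -(ltr_pXn2r (n := 2)) ?nnegrE ?normr_ge0 ?ltW //.
  by apply: (le_lt_trans (J_par _ _)); lra.
move=> /cvg_ex[g Fg].
have Jc : J u @[u --> F] --> J g.
  have nc : `|u| @[u --> F] --> `|g| by exact: cvg_norm.
  apply: cvgB; first exact: (cvgM nc nc).
  by apply: cvgMr; apply: cvg_comp Fg _; exact: lc.
have Jg : J g = m.
  apply/eqP; rewrite eq_le mJ andbT; apply/ler_addgt0Pr => e e0.
  rewrite -(cvg_lim _ Jc) //; apply: limr_le; first by apply/cvg_ex; exists (J g).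
  by exists e => // u /ltW.
exists g => v.
have quad t : 0 <= t ^+ 2 * `|v| ^+ 2 + 2 * t * (ip g v - l v).
  have := mJ (g + t *: v); rewrite -Jg !JE lD lZ sqr_normD sqr_normZ ipZr.
  lra.
set d := ip g v - l v in quad; set a := `|v| ^+ 2 in quad.
have a0 : 0 <= a by exact: sqr_ge0.
suff : d = 0 by move/eqP; rewrite subr_eq0 => /eqP.
(* The minimiser [- d / a] would need [a] nonzero; with [1 + a] the value is still negative unless
   [d = 0]. *)
have := quad (- d / (1 + a)).
have -> : (- d / (1 + a)) ^+ 2 * a + 2 * (- d / (1 + a)) * d =
   - (d ^+ 2 * ((2 + a) / (1 + a) ^+ 2)) by field; lra.
rewrite oppr_ge0 pmulr_lle0; last by rewrite divr_gt0 ?exprn_gt0 //; lra.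
by move=> d2; apply/eqP; rewrite -sqrf_eq0 eq_le d2 sqr_ge0.
Qed.

(** * Gradients as subgradients of convex functions, and the resulting estimates *)

Implicit Types (f : H -> R^o) (U Omega : set H).

(** By Riesz the set inside [xget] is nonempty, so the default 0 is not what gets picked. *)
Lemma gradientP f x : gateaux_differentiable f x ->
  forall v, is_derive x v f (ip (gradient ip f x) v).
Proof.
move=> [l [lc dl]]; have [g lg] := riesz _ lc.
apply: (xgetPex 0 (P := [set g | forall v, is_derive x v f (ip g v)])).
by exists g => v /=; rewrite -lg.
Qed.

Lemma differentiable_gateaux f x :
  differentiable f x -> gateaux_differentiable f x.
Proof.
move=> df; exists ('d f x); split; first exact: diff_continuous.
by move=> v; apply: DeriveDef; [exact: diff_derivable|rewrite deriveE].
Qed.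

Lemma convex_tangent_le Omega f (x y : H) (d : R) : convex_function Omega f ->
  Omega x -> Omega y -> is_derive x (y - x) f d -> f x + d <= f y.
Proof.
move=> cf Ox Oy [dx dE].
rewrite addrC -lerBrDr -dE /derive.
(* Convexity bounds the difference quotient by [f y - f x] only for t in (0, 1], hence the limit
   from the right. *)
have fc := cvg_dnbhs_at_right dx.
rewrite -(cvg_lim _ fc) //; apply: limr_le.
  by apply/cvg_ex; eexists; exact: fc.
near=> t.
have t0 : 0 < t by near: t; exact: nbhs_right_gt.
have t1 : t <= 1 by near: t; apply: nbhs_right_le.
have h : f (t *: y + (1 - t) *: x) <= t * f y + (1 - t) * f x.
  by apply: (cf (Itv01 (ltW t0) t1)); rewrite inE.
rewrite scalerBl scale1r addrCA -scalerBr addrC in h.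
rewrite -[_ *: _]/(t^-1 * (f (t *: (y - x) + x) - f x)).
by rewrite ler_pdivrMl //; lra.
Unshelve. all: by end_near. Qed.

(** Abstracting the gradient to a selection of subgradients relative to [U] keeps derivatives out of
    the descent and cocoercivity estimates. *)
Definition subgradient_on U (f : H -> R) (g : H -> H) :=
  forall x y, U x -> U y -> f x + ip (g x) (y - x) <= f y.

(** The subgradient at [z], tested at [y], bounds [f z] from above; replacing [g z] by [g y] costs
    [ip (g z - g y) (z - y)], which Cauchy-Schwarz controls. *)
Lemma subgradient_descent U f g (L : R) y z : subgradient_on U f g ->
  U y -> U z -> `|g z - g y| <= L * `|z - y| ->
  f z <= f y + ip (g y) (z - y) + L * `|z - y| ^+ 2.
Proof.
move=> sg Uy Uz lip; have := sg _ _ Uz Uy.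
have := ip_cauchy_schwarz (g z - g y) (z - y).
have := ler_wpM2r (normr_ge0 (z - y)) lip.
rewrite -mulrA -expr2 ipBl -(opprB z y) -[- (z - y)]scaleN1r ipZr.
lra.
Qed.

Lemma subgradient_cocoercive f g (x0 : H) (r L : R) : 0 < L ->
  subgradient_on (ball x0 r) f g ->
  (forall y z, ball x0 r y -> ball x0 r z -> `|g y - g z| <= L * `|y - z|) ->
  cocoercive ip (2 * L)^-1 (ball x0 (r / 4)) g.
Proof.
move=> L0 sg lip.
have step x y : ball x0 (r / 4) x -> ball x0 (r / 4) y ->
  f x + ip (g x) (y - x) + (4 * L)^-1 * `|g y - g x| ^+ 2 <= f y.
  move=> bx by_; have r0 : 0 < r.
    by move: bx; rewrite -ball_normE /= => /(le_lt_trans (normr_ge0 _)); lra.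
  have Bx : ball x0 r x by apply: le_ball bx; lra.
  have By : ball x0 r y by apply: le_ball by_; lra.
  (* Along [y - t *: d] the bound on [f - ip (g x)] changes by [(L * t ^+ 2 - t) * |d| ^+ 2], least
     at [t = (2 * L)^-1], where it is [- (4 * L)^-1 * |d| ^+ 2]. *)
  pose d := g y - g x; pose z := y - (2 * L)^-1 *: d.
  have zy : z - y = - (2 * L)^-1 *: d by rewrite /z addrAC subrr add0r scaleNr.
  have nzy : `|z - y| = (2 * L)^-1 * `|d|.
    by rewrite zy normrZ normrN gtr0_norm // invr_gt0; lra.
  (* The distance from [x0] to [z] is below r/4 + r/2, since [z] is no further from [y] than [x]
     is. *)
  have Bz : ball x0 r z.
    move: bx by_; rewrite -!ball_normE /= => bx by_.
    have xy : `|y - x| < r / 2.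
      by have := ler_distD x0 y x; rewrite (distrC y x0); lra.
    have zyx : `|z - y| <= `|y - x|.
      rewrite nzy ler_pdivrMl; last lra.
      have := lip _ _ By Bx; rewrite -/d; have := normr_ge0 (y - x); nra.
    have := ler_distD y x0 z; rewrite (distrC y z); lra.
  have := subgradient_descent _ _ _ _ _ _ sg By Bz (lip _ _ Bz By).
  have := sg _ _ Bx Bz; rewrite -[z - x](subrKA y) ipDr nzy zy !ipZr.
  have -> : ip (g y) d = `|d| ^+ 2 + ip (g x) d.
    by rewrite -ip_normE {2}/d ipBl subrK.
  have -> : L * ((2 * L)^-1 * `|d|) ^+ 2 = (4 * L)^-1 * `|d| ^+ 2.
    by field; rewrite gt_eqF.
  have -> : (2 * L)^-1 = 2 * (4 * L)^-1 by field; rewrite gt_eqF.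
  lra.
(* Adding the two instances cancels the values of [f] and doubles [(4 * L)^-1]. *)
move=> x y bx by_; have := step _ _ bx by_; have := step _ _ by_ bx.
have -> : (2 * L)^-1 = 2 * (4 * L)^-1 by field; rewrite gt_eqF.
rewrite (distrC (g y)) -(opprB x y) -[- (x - y)]scaleN1r ipZr ipBl; lra.
Qed.

Lemma cocoercive_lipschitz (beta : R) U T : 0 < beta -> cocoercive ip beta U T ->
  forall x y, U x -> U y -> `|T x - T y| <= beta^-1 * `|x - y|.
Proof.
move=> b0 co x y Ux Uy; rewrite ler_pdivlMl //.
have [->|n0] := eqVneq (T x - T y) 0; first by rewrite normr0 mulr0.
rewrite -(ler_pM2l (x := `|T x - T y|)) ?normr_gt0 //.
apply: le_trans (ip_cauchy_schwarz _ _); apply: le_trans (co _ _ Ux Uy).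
by rewrite le_eqVlt; apply/orP; left; apply/eqP; ring.
Qed.

(** The first-order remainder lies between 0 and [L * |h| ^+ 2], hence is o(h). Gateaux
    differentiability supplies the continuous linear map that becomes the differential. *)
Lemma subgradient_differentiable U f g (L : R) x : nbhs x U -> 0 < L ->
  subgradient_on U f g ->
  (forall y, U y -> `|g y - g x| <= L * `|y - x|) ->
  gateaux_differentiable f x -> (forall v, is_derive x v f (ip (g x) v)) ->
  differentiable f x.
Proof.
move=> nU L0 sg lip [l [lc dl]] dg.
have lE v : l v = ip (g x) v.
  by have [_ <-] := dl v; have [_ <-] := dg v.
have fE : f \o shift x = cst (f x) + l +o_ (0 : H) id.
  apply/eqaddoE/eqaddoP => e e0.
  have nU0 : \forall h \near (0 : H), U (h + x).
    by move: nU; rewrite -[nbhs x U]/(\forall y \near x, U y) (near_shift 0 x) subr0.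
  near=> h.
  have Uh : U (h + x) by near: h.
  have Ux := nbhs_singleton nU.
  have hx : h + x - x = h by rewrite addrK.
  have := sg _ _ Ux Uh.
  have := subgradient_descent _ _ _ _ _ _ sg Ux Uh (lip _ Uh).
  rewrite hx -lE => h1 h2.
  rewrite -[X in `|X|]/(f (h + x) - (f x + l h)).
  have hs : `|h| <= e / L.
    near: h; apply/nbhs_ballP; exists (e / L) => /=; first by rewrite divr_gt0.
    by move=> h; rewrite -ball_normE /= sub0r normrN => /ltW.
  rewrite ger0_norm ?subr_ge0 //.
  have : L * `|h| ^+ 2 <= e * `|h|.
    by rewrite expr2 mulrA ler_wpM2r // -ler_pdivlMl // mulrC.
  lra.
have dE := diff_unique lc fE.
by apply/diff_locallyP; rewrite dE.
Unshelve. all: by end_near. Qed.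

End InnerProduct.

(** * Both implications, on a neighbourhood of each point *)

Theorem corollary3p1 (R : realType) (H : completeNormedModType R)
    (ip : {dot H for idfun}) (ip_norm : induces_norm ip)
    (Omega : set H) (Omega0 : Omega !=set0) (oOmega : open Omega)
    (cOmega : convex_set Omega)
    (f : H -> R^o) (cf : convex_function Omega f) :
  C1plus ip Omega f <->
  (forall x, Omega x -> gateaux_differentiable f x) /\
  locally_cocoercive ip Omega (gradient ip f).
Proof.
have subgrad : (forall x, Omega x -> gateaux_differentiable f x) ->
    subgradient_on ip Omega f (gradient ip f).
  move=> gf x y Ox Oy; apply: (convex_tangent_le Omega) => //.
  exact: (gradientP ip ip_norm f x (gf x Ox)).
have sub U V : U `<=` V -> subgradient_on ip V f (gradient ip f) ->
    subgradient_on ip U f (gradient ip f).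
  by move=> UV sg x y /UV Vx /UV Vy; exact: sg.
split=> [[df lip]|[gf co]].
  have gf x : Omega x -> gateaux_differentiable f x.
    by move=> /df; exact: differentiable_gateaux.
  (* The Lipschitz property holds for all constants near [+oo], so a positive [L] can be chosen. *)
  split=> // x Ox; have [U [nU UO /pinfty_ex_gt0[L L0 lipU]]] := lip x Ox.
  have [r /= r0 rU] := (nbhs_ballP x U).1 nU.
  exists (ball x (r / 4)), (2 * L)^-1; split.
  - by apply: nbhsx_ballx; rewrite divr_gt0.
  - by apply: subset_trans UO; apply: subset_trans rU; apply: le_ball; lra.
  - by rewrite invr_gt0 mulr_gt0.
  - apply: (subgradient_cocoercive ip ip_norm f) => //.
      by apply: sub (subgrad gf); exact: subset_trans UO.
    by move=> y z /rU Uy /rU Uz; exact: (lipU (y, z)).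
split=> x Ox; have [U [beta [nU UO b0 coU]]] := co x Ox;
    have lip := cocoercive_lipschitz ip ip_norm _ _ _ b0 coU.
  apply: (subgradient_differentiable ip ip_norm U f (gradient ip f) beta^-1) => //.
  - by rewrite invr_gt0.
  - exact: sub (subgrad gf).
  - by move=> y Uy; apply: lip => //; exact: nbhs_singleton.
  - exact: gf.
  - exact: (gradientP ip ip_norm f x (gf x Ox)).
exists U; split=> //.
have Ux := nbhs_singleton nU.
(* The pair [(x, x)] witnesses that the filter of pairs in [U] is proper. *)
apply: (klipschitzW (PF := @globally_properfilter _ _ (x, x) (conj Ux Ux))).
by move=> [y z] [Uy Uz] /=; exact: lip.
Qed.
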